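(* For all integers $n\ge 1$, $$n!\le \sqrt{2\pi n}\left(\frac{n}{e}\right)^n \exp\left(\frac{1}{12n}-\frac{1}{360n^3}+\frac{1}{1260n^5}-\frac{1}{1680n^7+2376n^5}\right).$$
   Context: Here $e$ is the base of the natural logarithm, $\exp(x)=e^x$, and $n!$ is the usual factorial. *)

(* Defs.v *)
From Stdlib Require Export Reals Factorial.

(* Main.v *)
Require Import Defs.
From Stdlib Require Import Reals Factorial.
From Stdlib Require Import Lra Lia.
From Coquelicot Require Import Coquelicot.
Open Scope R_scope.

(** Let L(n) = ln n! - (n + 1/2) ln n + n ([stirling_log]), and let rho(1/n)
    ([rho]) be the exponent on the right-hand side of the theorem. Taking
    logarithms, the claim is L(n) - rho(1/n) <= ln(2 pi)/2. It holds because the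
    sequence on the left increases to that limit.

    Monotonicity: since L(n) - L(n+1) = (n + 1/2) ln(1 + 1/n) - 1, it amounts to
    ln(1+y) <= 2y/(2+y) (1 + rho(y) - rho(y/(1+y))) at y = 1/n, where
    y/(1+y) = 1/(n+1). This is [ln_upper], and it is true for every real y >= 0:
    both sides vanish at 0 and the difference of their derivatives is a rational
    function whose numerator and denominator have only nonnegative coefficients.

    Limit: the cruder bound ln(1+y) >= 2y/(2+y) ([ln_lower]) makes L decreasing,
    hence L(n) - rho(1/n) is bounded above and converges to some l; the term rho(1/n)
    tends to 0. The powers of n cancel in 2 L(n) - L(2n), which is then an
    expression in the central binomial coefficient, and this coefficient is
    governed by the Wallis integrals of sin^n over [0, pi/2]. They give
    2 L(n) - L(2n) <= ln(2 pi)/2 + 1/n ([stirling_log_duplication]), so in the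
    limit l = 2l - l <= ln(2 pi)/2, which is the only half of Stirling's limit
    that is required. *)

(** * Bounds on the logarithm *)

(** The variable is y = 1/n and not n: the function is then regular at y = 0,
    and estimates at infinity become estimates between functions vanishing at 0. *)
Definition rho (y : R) : R :=
  y / 12 - y ^ 3 / 360 + y ^ 5 / 1260 - y ^ 7 / (1680 + 2376 * y ^ 2).

Lemma nonneg_of_derive_nonneg (f df : R -> R) (y : R) :
  0 <= y -> f 0 = 0 ->
  (forall x, 0 <= x -> is_derive f x (df x)) ->
  (forall x, 0 <= x -> 0 <= df x) ->
  0 <= f y.
Proof.
intros Hy H0 Hd Hp.
destruct (Req_dec y 0) as [->|Hy0]; [lra|].
destruct (MVT_gen f 0 y df) as [c [Hc E]].
- rewrite Rmin_left, Rmax_right by lra. intros x Hx. apply Hd; lra.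
- rewrite Rmin_left, Rmax_right by lra. intros x Hx.
  apply continuity_pt_filterlim, (ex_derive_continuous (V := R_NormedModule)).
  exists (df x). apply Hd; lra.
- rewrite Rmin_left, Rmax_right in Hc by lra.
  assert (0 <= df c * (y - 0)) by (apply Rmult_le_pos; [apply Hp|]; lra).
  lra.
Qed.

(** Both sides vanish at 0, and the difference of their derivatives is
    y^2 over a positive quantity. *)
Lemma ln_lower (y : R) : 0 <= y -> 2 * y / (2 + y) <= ln (1 + y).
Proof.
intros Hy.
enough (0 <= ln (1 + y) - 2 * y / (2 + y)) by lra.
apply (nonneg_of_derive_nonneg (fun y => ln (1 + y) - 2 * y / (2 + y))
         (fun y => y ^ 2 / ((1 + y) * (2 + y) ^ 2))); auto.
- replace (1 + 0) with 1 by ring. rewrite ln_1. unfold rho. field.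
- intros x Hx. auto_derive; [repeat split; lra|]. field. split; lra.
- intros x Hx. apply Rdiv_le_0_compat; [apply pow2_ge_0|].
  apply Rmult_lt_0_compat; [lra|apply pow_lt; lra].
Qed.

(** Closed form of the derivative of the right side minus the left side
    of [ln_upper]. The factor y^10 records how closely the two sides agree at 0;
    what remains of the numerator has positive coefficients, so the sign is
    visible. The factors 70 + 99 y^2 and 70 (1+y)^2 + 99 y^2 come from the
    denominator 1680 + 2376 y^2 of [rho] taken at y and at y/(1+y). *)
Definition upper_slope (y : R) : R :=
  y ^ 10 *
  (1029000 + 5145000 * y + 12599536600 * y ^ 2 + 50367276400 * y ^ 3
   + 110692836030 * y ^ 4 + 155814649690 * y ^ 5 + 160378894774 * y ^ 6
   + 119818239198 * y ^ 7 + 55555757418 * y ^ 8 + 13222743534 * y ^ 9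
   + 1314805635 * y ^ 10)
  / (1260 * (1 + y) ^ 6 * (2 + y) ^ 2 * (70 + 99 * y ^ 2) ^ 2
     * (70 * (1 + y) ^ 2 + 99 * y ^ 2) ^ 2).

(** At y = 1/n this bounds the decrease of [stirling_log] from n to n+1 by that
    of the correction: y/(1+y) is 1/(n+1) and 2y/(2+y) is 1/(n + 1/2). *)
Lemma ln_upper (y : R) :
  0 <= y -> ln (1 + y) <= 2 * y / (2 + y) * (1 + rho y - rho (y / (1 + y))).
Proof.
intros Hy.
enough (0 <= 2 * y / (2 + y) * (1 + rho y - rho (y / (1 + y))) - ln (1 + y)) by lra.
apply (nonneg_of_derive_nonneg
  (fun y => 2 * y / (2 + y) * (1 + rho y - rho (y / (1 + y))) - ln (1 + y))
  upper_slope); auto.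
- replace (1 + 0) with 1 by ring. rewrite ln_1. unfold rho. field.
- intros x Hx. unfold rho. auto_derive.
  + pose proof (pow2_ge_0 x). pose proof (pow2_ge_0 (x * / (1 + x))).
    simpl in *. repeat split; lra.
  + unfold upper_slope. field.
    repeat split; try lra; nra.
- intros x Hx. unfold upper_slope. apply Rdiv_le_0_compat.
  + assert (forall k, 0 <= x ^ k) by (intro; apply pow_le; lra).
    apply Rmult_le_pos; [auto|].
    pose proof (H 2%nat); pose proof (H 3%nat); pose proof (H 4%nat);
    pose proof (H 5%nat); pose proof (H 6%nat); pose proof (H 7%nat);
    pose proof (H 8%nat); pose proof (H 9%nat); pose proof (H 10%nat). lra.
  + repeat apply Rmult_lt_0_compat; try apply pow_lt; nra.
Qed.

(** * Wallis integrals *)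

Definition wallis (n : nat) : R := RInt (fun x => sin x ^ n) 0 (PI / 2).

Lemma ex_RInt_sin_pow (n : nat) (a b : R) : ex_RInt (fun x => sin x ^ n) a b.
Proof.
apply (ex_RInt_continuous (V := R_CompleteNormedModule)). intros x _.
apply (ex_derive_continuous (V := R_NormedModule)). auto_derive. exact I.
Qed.

(** Integration by parts, in the form that
    - cos x (sin x)^(n+1), which vanishes at both ends, has derivative
    (n+2) (sin x)^(n+2) - (n+1) (sin x)^n. *)
Lemma wallis_rec (n : nat) :
  INR (n + 2) * wallis (n + 2) = INR (n + 1) * wallis n.
Proof.
assert (H : is_RInt (fun x => INR (n + 2) * sin x ^ (n + 2)
                               - INR (n + 1) * sin x ^ n) 0 (PI / 2)
              (INR (n + 2) * wallis (n + 2) - INR (n + 1) * wallis n)).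
{ apply (is_RInt_minus (V := R_NormedModule));
  apply (is_RInt_scal (V := R_NormedModule));
  apply (RInt_correct (V := R_CompleteNormedModule)), ex_RInt_sin_pow. }
assert (H' : is_RInt (fun x => INR (n + 2) * sin x ^ (n + 2)
                               - INR (n + 1) * sin x ^ n) 0 (PI / 2)
              (- cos (PI / 2) * sin (PI / 2) ^ (n + 1)
               - - cos 0 * sin 0 ^ (n + 1))).
{ apply (is_RInt_derive (V := R_CompleteNormedModule)
           (fun x => - cos x * sin x ^ (n + 1))).
  - intros x _. auto_derive; [exact I|].
    replace (pred (n + 1)) with n by lia.
    rewrite !plus_INR, !pow_add. change (INR 1) with 1; change (INR 2) with 2.
    pose proof (sin2_cos2 x) as E. unfold Rsqr in E.
    transitivity (sin x ^ n * (sin x ^ 2 - (INR n + 1) * (cos x * cos x)));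
      [simpl; ring|].
    replace (cos x * cos x) with (1 - sin x * sin x) by lra. ring.
  - intros x _. apply (ex_derive_continuous (V := R_NormedModule)).
    auto_derive. repeat split. }
apply (is_RInt_unique (V := R_CompleteNormedModule)) in H, H'.
rewrite H in H'. rewrite cos_PI2, sin_0, pow_i in H' by lia. lra.
Qed.

Lemma wallis_decr (n : nat) : wallis (S n) <= wallis n.
Proof.
apply RInt_le; try apply ex_RInt_sin_pow; [pose proof PI_RGT_0; lra|].
intros x Hx.
assert (0 <= sin x) by (apply sin_ge_0; pose proof PI_RGT_0; lra).
pose proof (SIN_bound x). simpl.
rewrite <- (Rmult_1_l (sin x ^ n)) at 2.
apply Rmult_le_compat_r; [apply pow_le|]; lra.
Qed.

Lemma wallis_0 : wallis 0 = PI / 2.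
Proof.
unfold wallis. simpl. rewrite RInt_const. unfold scal; simpl; unfold mult; simpl. ring.
Qed.

Lemma wallis_1 : wallis 1 = 1.
Proof.
unfold wallis.
replace 1 with (- cos (PI / 2) - - cos 0) by (rewrite cos_PI2, cos_0; ring).
apply (is_RInt_unique (V := R_CompleteNormedModule)).
apply (is_RInt_derive (V := R_CompleteNormedModule) (fun x => - cos x)).
- intros x _. auto_derive; [exact I|ring].
- intros x _. apply (ex_derive_continuous (V := R_NormedModule)).
  auto_derive. exact I.
Qed.

(** By [wallis_rec] the left-hand side does not depend on n, and at n = 0 it is
    the product of the two initial integrals. *)
Lemma wallis_prod (n : nat) : INR (n + 1) * (wallis n * wallis (n + 1)) = PI / 2.
Proof.
induction n as [|n IH].
- simpl. rewrite wallis_0, wallis_1. ring.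
- rewrite <- IH. pose proof (wallis_rec n) as E.
  replace (S n + 1)%nat with (n + 2)%nat by lia.
  replace (S n) with (n + 1)%nat by lia.
  transitivity (wallis (n + 1) * (INR (n + 2) * wallis (n + 2))); [ring|].
  rewrite E. ring.
Qed.

Lemma wallis_even (n : nat) :
  wallis (2 * n) = INR (fact (2 * n)) / (4 ^ n * INR (fact n) ^ 2) * (PI / 2).
Proof.
induction n as [|n IH].
- simpl. rewrite wallis_0. field.
- assert (Hf := INR_fact_neq_0 n). assert (Hn := pos_INR n).
  assert (H4 : (4 ^ n) <> 0) by (apply pow_nonzero; lra).
  apply Rmult_eq_reg_l with (INR (2 * n + 2)).
  2:{ apply not_0_INR; lia. }
  replace (2 * S n)%nat with (2 * n + 2)%nat by lia.
  rewrite wallis_rec, IH.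
  replace (2 * n + 2)%nat with (S (S (2 * n))) by lia.
  rewrite !fact_simpl, !mult_INR, !S_INR, !plus_INR, !mult_INR. change (INR 1) with 1. change (INR 2) with 2.
  simpl pow. field. repeat split; lra.
Qed.

Lemma wallis_even_pos (n : nat) : 0 < wallis (2 * n).
Proof.
rewrite wallis_even. pose proof (INR_fact_lt_0 n). pose proof (INR_fact_lt_0 (2 * n)).
pose proof PI_RGT_0.
apply Rmult_lt_0_compat; [|lra]. apply Rdiv_lt_0_compat; auto.
apply Rmult_lt_0_compat; apply pow_lt; lra.
Qed.

(** Monotonicity turns the product of consecutive integrals in [wallis_prod]
    into a square. *)
Lemma wallis_lower (n : nat) :
  PI / 2 <= (2 * INR n + 1) * wallis (2 * n) ^ 2.
Proof.
rewrite <- (wallis_prod (2 * n)), plus_INR, mult_INR. change (INR 1) with 1. change (INR 2) with 2.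
pose proof (pos_INR n). pose proof (wallis_even_pos n).
apply Rmult_le_compat_l; [lra|].
pose proof (wallis_decr (2 * n)) as Hd.
replace (S (2 * n)) with (2 * n + 1)%nat in Hd by lia.
rewrite <- Rsqr_pow2. unfold Rsqr. apply Rmult_le_compat_l; lra.
Qed.

(** * Stirling's sequence *)

Definition stirling_log (n : nat) : R :=
  ln (INR (fact n)) - (INR n + 1 / 2) * ln (INR n) + INR n.

Lemma stirling_log_step (n : nat) :
  (1 <= n)%nat ->
  stirling_log n - stirling_log (S n) = (INR n + 1 / 2) * ln (1 + / INR n) - 1.
Proof.
intros Hn. assert (0 < INR n) by (apply lt_0_INR; lia).
unfold stirling_log. rewrite fact_simpl, mult_INR, S_INR.
rewrite ln_mult by (try apply INR_fact_lt_0; lra).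
replace (1 + / INR n) with ((INR n + 1) / INR n) by (field; lra).
rewrite ln_div by lra. ring.
Qed.

Lemma stirling_log_decr (n : nat) :
  (1 <= n)%nat -> stirling_log (S n) <= stirling_log n.
Proof.
intros Hn. assert (H : 0 < INR n) by (apply lt_0_INR; lia).
pose proof (stirling_log_step n Hn).
assert (Hi : 0 < / INR n) by (apply Rinv_0_lt_compat; lra).
pose proof (ln_lower (/ INR n) (Rlt_le _ _ Hi)) as Hl.
apply (Rmult_le_compat_l (INR n + 1 / 2)) in Hl; [|lra].
replace ((INR n + 1 / 2) * (2 * / INR n / (2 + / INR n))) with 1 in Hl
  by (field; split; lra).
lra.
Qed.

Lemma stirling_log_corrected_incr (n : nat) :
  (1 <= n)%nat ->
  stirling_log n - rho (/ INR n) <= stirling_log (S n) - rho (/ INR (S n)).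
Proof.
intros Hn. assert (H : 0 < INR n) by (apply lt_0_INR; lia).
pose proof (stirling_log_step n Hn).
assert (Hi : 0 < / INR n) by (apply Rinv_0_lt_compat; lra).
pose proof (ln_upper (/ INR n) (Rlt_le _ _ Hi)) as Hl.
apply (Rmult_le_compat_l (INR n + 1 / 2)) in Hl; [|lra].
replace (/ INR n / (1 + / INR n)) with (/ INR (S n)) in Hl
  by (rewrite S_INR; field; split; lra).
rewrite <- Rmult_assoc in Hl.
replace ((INR n + 1 / 2) * (2 * / INR n / (2 + / INR n))) with 1 in Hl
  by (field; split; lra).
lra.
Qed.

(** Crude bounds, whose purpose is that rho(1/n) tends to 0 and that subtracting it
    keeps [stirling_log] bounded above. *)
Lemma rho_bounds (y : R) : 0 <= y <= 1 -> 0 <= rho y <= y.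
Proof.
intros Hy. unfold rho.
assert (H2 : 0 <= y ^ 2 <= 1) by (simpl; nra).
assert (Hk : forall k, 0 <= y ^ k) by (intro; apply pow_le; lra).
assert (Hm : forall k, 0 <= y ^ (k + 2) <= y ^ k).
{ intro k. split; [apply Hk|]. rewrite pow_add.
  rewrite <- (Rmult_1_r (y ^ k)) at 2. apply Rmult_le_compat_l; [apply Hk|lra]. }
pose proof (Hm 1%nat) as H3. pose proof (Hm 3%nat) as H5. pose proof (Hm 5%nat) as H7.
simpl Nat.add in *. rewrite pow_1 in H3.
assert (0 <= y ^ 7 / (1680 + 2376 * y ^ 2) <= y ^ 7 / 1680).
{ split.
  - apply Rdiv_le_0_compat; lra.
  - apply Rmult_le_compat_l; [lra|]. apply Rinv_le_contravar; lra. }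
lra.
Qed.

(** All terms in n ln n cancel on the left, which becomes
    ln (pi/2) + (ln 2 - ln n) / 2 - ln (wallis (2n)) by [wallis_even]; then
    [wallis_lower] applies, and 1/n absorbs the difference between
    ln (2n + 1) and ln (2n). *)
Lemma stirling_log_duplication (n : nat) :
  (1 <= n)%nat ->
  2 * stirling_log n - stirling_log (2 * n) <= ln (2 * PI) / 2 + / INR n.
Proof.
intros Hn. assert (H : 0 < INR n) by (apply lt_0_INR; lia).
assert (Hi : 0 < / INR n) by (apply Rinv_0_lt_compat; lra).
pose proof PI_RGT_0 as Hpi. pose proof (INR_fact_lt_0 n) as Hf.
pose proof (INR_fact_lt_0 (2 * n)) as Hf2.
pose proof (wallis_even_pos n) as Hw.
assert (H4 : 0 < 4 ^ n) by (apply pow_lt; lra).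
assert (Hf' : 0 < INR (fact n) ^ 2) by (apply pow_lt; lra).
assert (E : ln (wallis (2 * n)) =
  ln (INR (fact (2 * n))) - 2 * INR n * ln 2 - 2 * ln (INR (fact n)) + ln PI - ln 2).
{ rewrite wallis_even, ln_mult, !ln_div, ln_mult, !ln_pow; try lra.
  - replace 4 with (2 * 2) by ring. rewrite ln_mult by lra. change (INR 2) with 2. ring.
  - apply Rmult_lt_0_compat; auto.
  - apply Rdiv_lt_0_compat; auto. apply Rmult_lt_0_compat; auto. }
pose proof (wallis_lower n) as Hl.
apply ln_le in Hl; [|lra].
assert (Hs : ln (2 * INR n + 1) <= ln 2 + ln (INR n) + / INR n).
{ replace (2 * INR n + 1) with (2 * INR n * (1 + / (2 * INR n))) by (field; lra).
  assert (Hj : 0 < / (2 * INR n)) by (apply Rinv_0_lt_compat; lra).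
  rewrite !ln_mult by lra.
  assert (ln (1 + / (2 * INR n)) <= / (2 * INR n)).
  { rewrite <- (ln_exp (/ (2 * INR n))) at 2. apply ln_le; [lra|].
    apply Rlt_le, exp_ineq1; lra. }
  rewrite Rinv_mult in *. lra. }
rewrite ln_div, ln_mult, ln_pow, E in Hl by (try apply pow_lt; lra).
change (INR 2) with 2 in Hl.
unfold stirling_log. rewrite mult_INR. change (INR 2) with 2.
rewrite !ln_mult by lra. lra.
Qed.

(** The increasing sequence t(k) = L(k+1) - rho(1/(k+1)) has a limit l and stays
    below it. Bounding t at the doubled argument by l in
    [stirling_log_duplication] gives t <= (ln(2 pi)/2 + l)/2 + o(1), and the limit
    gives l <= ln(2 pi)/2. *)
Lemma stirling_log_le (n : nat) :
  (1 <= n)%nat -> stirling_log n <= ln (2 * PI) / 2 + rho (/ INR n).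
Proof.
intros Hn.
set (t := fun k => stirling_log (S k) - rho (/ INR (S k))).
assert (Hinv : forall k, 0 <= / INR (S k) <= 1).
{ intro k. rewrite S_INR. pose proof (pos_INR k). split.
  - apply Rlt_le, Rinv_0_lt_compat; lra.
  - rewrite <- Rinv_1. apply Rinv_le_contravar; lra. }
assert (Hincr : forall k, t k <= t (S k)).
{ intro k. apply stirling_log_corrected_incr; lia. }
assert (Hbd : forall k, t k <= stirling_log 1).
{ intro k. apply Rle_trans with (stirling_log (S k)).
  - unfold t. pose proof (rho_bounds _ (Hinv k)). lra.
  - induction k as [|k IH]; [lra|].
    eapply Rle_trans; [apply stirling_log_decr; lia|exact IH]. }
destruct (ex_finite_lim_seq_incr t _ Hincr Hbd) as [l Hl].
pose proof (is_lim_seq_incr_compare t l Hl Hincr) as Hle.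
(* Since t is indexed from n = 1, the argument 2(k+1) is reached at index 2k+1. *)
assert (Hhalf : forall k, t k <= (ln (2 * PI) / 2 + l) / 2 + / INR (S k)).
{ intro k. pose proof (stirling_log_duplication (S k) ltac:(lia)) as Hd.
  pose proof (Hle (2 * k + 1)%nat) as H2. unfold t in *.
  replace (S (2 * k + 1)) with (2 * S k)%nat in H2 by lia.
  pose proof (rho_bounds _ (Hinv k)).
  pose proof (rho_bounds _ (Hinv (2 * k + 1)%nat)) as Hr.
  replace (S (2 * k + 1)) with (2 * S k)%nat in Hr by lia.
  assert (/ INR (2 * S k) = / INR (S k) / 2).
  { rewrite mult_INR, Rinv_mult. change (INR 2) with 2. field. apply not_0_INR; lia. }
  pose proof (Hinv k). lra. }
assert (Hlim : is_lim_seq (fun k => (ln (2 * PI) / 2 + l) / 2 + / INR (S k))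
                 ((ln (2 * PI) / 2 + l) / 2 + 0)).
{ apply is_lim_seq_plus'; [apply is_lim_seq_const|].
  apply (is_lim_seq_incr_1 (fun k => / INR k)).
  apply (is_lim_seq_inv INR p_infty); [apply is_lim_seq_INR|discriminate]. }
pose proof (is_lim_seq_le _ _ _ _ Hhalf Hl Hlim) as Hfin. simpl in Hfin.
pose proof (Hle (pred n)) as Hn'. unfold t in Hn'.
replace (S (pred n)) with n in Hn' by lia. lra.
Qed.

Lemma ln_sqrt (x : R) : 0 < x -> ln (sqrt x) = ln x / 2.
Proof.
intros Hx. pose proof (sqrt_lt_R0 x Hx).
rewrite <- (sqrt_sqrt x) at 2 by lra. rewrite ln_mult by lra. field.
Qed.

Theorem mainTheorem5 (n : nat) (hn : (1 <= n)%nat) :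
  INR (fact n) <=
    sqrt (2 * PI * INR n) * (INR n / exp 1) ^ n *
    exp (1 / (12 * INR n) - 1 / (360 * INR n ^ 3) + 1 / (1260 * INR n ^ 5)
         - 1 / (1680 * INR n ^ 7 + 2376 * INR n ^ 5)).
Proof.
assert (H : 0 < INR n) by (apply lt_0_INR; lia).
pose proof PI_RGT_0. pose proof (exp_pos 1).
assert (Hr : 1 / (12 * INR n) - 1 / (360 * INR n ^ 3) + 1 / (1260 * INR n ^ 5)
         - 1 / (1680 * INR n ^ 7 + 2376 * INR n ^ 5) = rho (/ INR n)).
{ pose proof (pow_lt _ 2 H). pose proof (pow_lt _ 5 H). pose proof (pow_lt _ 7 H).
  unfold rho. field. repeat split; lra. }
rewrite Hr.
assert (Hx : 0 < 2 * PI * INR n) by (apply Rmult_lt_0_compat; lra).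
pose proof (sqrt_lt_R0 _ Hx).
assert (Hp : 0 < INR n / exp 1) by (apply Rdiv_lt_0_compat; lra).
assert (Hpn : 0 < (INR n / exp 1) ^ n) by (apply pow_lt; lra).
pose proof (exp_pos (rho (/ INR n))).
apply Rnot_lt_le. intros Hlt.
apply ln_increasing in Hlt; [|repeat apply Rmult_lt_0_compat; auto].
apply (Rlt_not_le _ _ Hlt). clear Hlt.
rewrite !ln_mult, ln_exp, ln_pow, ln_div, ln_exp, ln_sqrt; auto.
- rewrite ln_mult by lra.
  pose proof (stirling_log_le n hn) as Hl. unfold stirling_log in Hl. lra.
- apply Rmult_lt_0_compat; auto.
Qed.
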